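(* The class of apple-free graphs has the polynomial CS-Separation property: there is a polynomial $P$ such that every apple-free graph $G$ admits a CS-Separator of size at most $P(|V(G)|)$.
   Context: A cut of $G$ is a partition $(W,W')$ of $V(G)$; it separates disjoint $K,S$ if $K\subseteq W$, $S\subseteq W'$. A CS-Separator of $G$ is a family of cuts such that every clique $K$ and stable set $S$ of $G$ with $K\cap S=\emptyset$ are separated by some cut; its size is the number of cuts. An apple $A_k$ ($k\ge4$) is the graph obtained from a chordless cycle on $k$ vertices by adding one vertex having exactly one neighbor on the cycle. A graph is apple-free if it contains no $A_k$, $k\ge4$, as an induced subgraph. *)

(* Defs.v *)
From HB Require Import structures.
From mathcomp Require Import all_boot all_order all_algebra.

Set Implicit Arguments.
Unset Strict Implicit.
Unset Printing Implicit Defensive.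

Record sgraph := SGraph {
  vertex :> finType;
  adj : rel vertex;
  adj_sym : symmetric adj;
  adj_irrefl : irreflexive adj
}.

Definition clique (G : sgraph) (K : {set G}) : Prop :=
  {in K &, forall x y : G, x != y -> adj x y}.

Definition stable (G : sgraph) (S : {set G}) : Prop :=
  {in S &, forall x y : G, ~~ adj x y}.

(* Unlike the blocks of [finset.partition], the sides of a cut may be empty;
   this is needed, e.g., to separate K = V(G) from S = set0. *)
Definition is_cut (G : sgraph) (c : {set G} * {set G}) : bool :=
  (c.1 :|: c.2 == [set: G]) && [disjoint c.1 & c.2].

Definition separates (G : sgraph) (c : {set G} * {set G}) (K S : {set G}) :
    bool :=
  (K \subset c.1) && (S \subset c.2).

Definition CS_separator (G : sgraph) (F : {set {set G} * {set G}}) : Prop :=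
  {in F, forall c, is_cut c} /\
  (forall K S : {set G}, clique K -> stable S -> [disjoint K & S] ->
     exists2 c, c \in F & separates c K S).

Definition induced_subgraph (H G : sgraph) : Prop :=
  exists2 f : H -> G, injective f & forall x y : H, adj (f x) (f y) = adj x y.

(* [Some i] is the i-th vertex of the cycle, [None] the additional vertex,
   whose unique neighbor is [Some 0]. The conjunct [i != j] only matters for
   k = 1, where [ordS] has a fixed point. *)
Definition apple_adj (k : nat) : rel (option 'I_k) := fun u v =>
  match u, v with
  | Some i, Some j => (i != j) && ((j == ordS i) || (i == ordS j))
  | Some i, None | None, Some i => val i == 0
  | None, None => false
  end.

Fact apple_adj_sym (k : nat) : symmetric (@apple_adj k).
Proof. by move=> [i|] [j|] //=; rewrite eq_sym orbC. Qed.

Fact apple_adj_irrefl (k : nat) : irreflexive (@apple_adj k).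
Proof. by move=> [i|] //=; rewrite eqxx. Qed.

Definition apple (k : nat) : sgraph :=
  SGraph (@apple_adj_sym k) (@apple_adj_irrefl k).

Definition apple_free (G : sgraph) : Prop :=
  forall k : nat, 4 <= k -> ~ induced_subgraph (apple k) G.

(* Natural-number coefficients lose no generality: on nat, a real polynomial
   is bounded by one with natural coefficients. *)
Definition poly_CS_separation (C : sgraph -> Prop) : Prop :=
  exists P : {poly nat}, forall G : sgraph, C G ->
    exists2 F : {set {set G} * {set G}},
      CS_separator F & #|F| <= horner P #|G|.

(* Main.v *)
Require Import Defs.
From mathcomp Require Import all_boot all_order all_algebra.
From mathcomp Require Import zify.

Set Implicit Arguments.
Unset Strict Implicit.
Unset Printing Implicit Defensive.

(** A cut (W, ~: W) is represented by its clique side W. Homogeneous sets and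
    clique cutsets split the problem into two smaller ones whose sizes add up,
    which reduces it to a graph G with neither. In such a G, let X be a
    component of the non-neighbours of d, and let u, v be nonadjacent
    neighbours of d attached to X. Then every neighbour of d is adjacent to u
    or v: otherwise d, u, a path through X and v form a hole, and the remaining
    neighbour is a pendant vertex on it (or on a similar hole).

    Given a vertex x of the clique K, start from A = N[x]. If A contains a
    stable set of size 3, there are such d, u, v with A in N[d], hence A covered
    by N[u] and N[v], but by neither alone. If K lies in N[u] or in N[v],
    recurse into that part of A; the parts share no stable triple, because G has
    no induced K_{2,3}, so counting stable triples bounds the recursion. If K
    lies in neither, the vertices of K that see only u are complete to those of
    S that see only u, up to boundedly many exceptions, and likewise for v, so
    boundedly many vertices describe a suitable cut. *)

(** * Holes with a pendant vertex, and shortest induced paths *)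

Definition induced_path (G : sgraph) (x0 : G) (p : seq G) : Prop :=
  forall i j, i < j < size p -> adj (nth x0 p i) (nth x0 p j) = (j == i.+1).

(** [v] closes [p] to a hole of length at least 4 on which [z] hangs at [v]. Listing the hole as
    [v :: p] puts [v] at index 0, where the apple has its pendant vertex. *)
Lemma hole_pendantF (G : sgraph) (x0 v z : G) (p : seq G) :
  apple_free G -> 2 < size p -> uniq (v :: p) -> induced_path x0 p ->
  (forall i, i < size p -> adj v (nth x0 p i) = (i == 0) || (i.+1 == size p)) ->
  adj z v -> {in p, forall y, ~~ adj z y} -> False.
Proof.
move=> afG lt2p Uvp ip_p vp zv zp.
have zNp: z \notin p.
  apply/negP => zp'; have := index_mem z p; rewrite zp' => lt_zp.
  have zE := nth_index x0 zp'.
  have := vp _ lt_zp; rewrite zE adj_sym zv => /esym /orP[/eqP i0|/eqP iE].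
    have z1 : adj z (nth x0 p 1) by rewrite -zE ip_p ?i0 //; lia.
    by have := zp _ (mem_nth x0 (ltnW lt2p)); rewrite z1.
  have lt_j : (index z p).-1 < size p by lia.
  have := zp _ (mem_nth x0 lt_j); rewrite adj_sym -[X in adj _ X]zE ip_p; last by lia.
  by rewrite prednK ?eqxx //; lia.
pose f (o : option 'I_(size p).+1) := if o is Some i then nth x0 (v :: p) i else z.
have zNvp: z \notin v :: p.
  by rewrite inE negb_or zNp andbT; apply/eqP => zE; rewrite zE adj_irrefl in zv.
have memf (i : 'I_(size p).+1) : f (Some i) \in v :: p by apply: mem_nth.
apply: (afG (size p).+1); first by lia.
exists f.
  move=> [i|] [j|] //=.
  - move/eqP; rewrite nth_uniq //= => /eqP ij; congr Some; exact: val_inj.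
  - by move=> E; have := memf i; rewrite /= E (negPf zNvp).
  - by move=> E; have := memf j; rewrite /= -E (negPf zNvp).
have zf (i : 'I_(size p).+1) : adj (f (Some i)) z = (val i == 0).
  rewrite /= adj_sym; case: i => [[|i] lt_i] //=.
  by apply/negbTE/zp/mem_nth.
have ff (i j : 'I_(size p).+1) : i < j ->
    adj (f (Some i)) (f (Some j)) = apple_adj (Some i) (Some j).
  move=> lt_ij /=; have lt_j := ltn_ord j.
  have -> : (i != j) by apply/eqP => E; rewrite E ltnn in lt_ij.
  rewrite -!val_eqE /= modn_small ?lt_ij; last by lia.
  have -> : (i == j.+1 %% (size p).+1 :> nat) = (i == 0 :> nat) && (j == size p :> nat).
    case: (eqVneq (j : nat) (size p)) => [->|jp]; first by rewrite modnn andbT.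
    by rewrite modn_small; lia.
  case: i lt_ij => [[|i] lt_i] /= lt_ij; case: j lt_ij lt_j => [[|j] lt_j] //= lt_ij _.
    by rewrite vp.
  by rewrite ip_p ?eqSS ?orbF //; lia.
move=> [i|] [j|]; rewrite ?zf //=.
- case: (ltngtP i j) => ij; first exact: (ff i j).
    by rewrite adj_sym [LHS](ff j i) //= eq_sym orbC.
  by rewrite (val_inj ij) eqxx adj_irrefl.
- by rewrite adj_sym; exact: zf.
- by rewrite adj_irrefl.
Qed.

Definition within (G : sgraph) (Q : {set G}) : rel G :=
  connect (fun x y => [&& x \in Q, y \in Q & adj x y]).

Lemma within_sym (G : sgraph) (Q : {set G}) : symmetric (within Q).
Proof.
by apply: sym_connect_sym => x y /=; rewrite adj_sym andbCA.
Qed.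

Lemma within_mem (G : sgraph) (Q : {set G}) (x y : G) :
  within Q x y -> x \in Q -> y \in Q.
Proof.
case/connectP => p; elim: p x => [|z p IHp] x /=; first by move=> _ ->.
by case/andP => /and3P[_ Qz _] pz yE _; exact: IHp pz yE Qz.
Qed.

(** Take a shortest path in [Q] from [A] to [B], not necessarily from [a] to [b]: cutting at a later
    vertex of [A] or an earlier one of [B], or along a chord, would shorten it. *)
Lemma shortest_path (G : sgraph) (x0 a b : G) (Q : {set G}) (A B : pred G) :
  a \in Q -> within Q a b -> A a -> B b ->
  exists p : seq G, [/\ 0 < size p, {subset p <= Q}, uniq p, induced_path x0 p &
    forall i, i < size p ->
      A (nth x0 p i) = (i == 0) /\ B (nth x0 p i) = (i.+1 == size p)].
Proof.
move=> Qa /connectP[q pq bE] Aa Bb.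
pose good (p : seq G) := [&& 0 < size p, all (mem Q) p, sorted (@adj G) p,
  A (nth x0 p 0) & B (nth x0 p (size p).-1)].
have good_q : good (a :: q).
  rewrite /good /= Aa Qa nth_last /= -bE Bb andbT /=.
  elim: q a pq Qa {bE Aa} => //= y q IHq x /andP[/and3P[_ Qy xy] pq] Qx.
  by rewrite Qy xy /=; exact: IHq.
pose P n := [exists p : n.-tuple G, good p].
have exP : exists n, P n.
  by exists (size (a :: q)); apply/existsP; exists (in_tuple (a :: q)).
case: (ex_minnP exP) => n /existsP[p good_p] min_p.
have{}min_p r : good r -> size p <= size r.
  move=> good_r; rewrite size_tuple; apply: min_p; apply/existsP.
  by exists (in_tuple r).
move: (tval p) good_p min_p => {n exP p P q pq bE good_q} p.
move=> /and5P[p_gt0 /allP Qp /(sortedP x0) srt_p Ap Bp] min_p.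
have headA i : i < size p -> A (nth x0 p i) = (i == 0).
  case: i => [|i] lt_i; first by rewrite Ap.
  apply/negP => Ai; suff /min_p : good (drop i.+1 p) by rewrite size_drop; lia.
  apply/and5P; rewrite size_drop !nth_drop addn0; split=> //; first by lia.
  - by apply/allP => y /mem_drop; exact: Qp.
  - by apply: drop_sorted; apply/(sortedP x0).
  - by have -> : i.+1 + (size p - i.+1).-1 = (size p).-1 by lia.
have lastB i : i < size p -> B (nth x0 p i) = (i.+1 == size p).
  move=> lt_i; case: eqP => [ip|/eqP ip]; first by have -> : i = (size p).-1 by lia.
  apply/negP => Bi; suff /min_p : good (take i.+1 p) by rewrite size_takel //; lia.
  apply/and5P; rewrite size_takel // !nth_take //=; split=> //.
  - by apply/allP => y /mem_take; exact: Qp.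
  - by apply: take_sorted; apply/(sortedP x0).
have ip : induced_path x0 p.
  move=> i j /andP[lt_ij lt_j]; case: eqP => [->|/eqP jNi]; first by apply: srt_p; lia.
  apply/negP => ij.
  suff /min_p : good (take i.+1 p ++ drop j p).
    by rewrite size_cat size_takel ?size_drop; lia.
  have szr : size (take i.+1 p ++ drop j p) = i.+1 + (size p - j).
    by rewrite size_cat size_takel ?size_drop; lia.
  have nthr k : nth x0 (take i.+1 p ++ drop j p) k =
      if k < i.+1 then nth x0 p k else nth x0 p (j + (k - i.+1)).
    rewrite nth_cat size_takel; last by lia.
    by case: ltnP => ki; rewrite ?nth_take ?nth_drop.
  apply/and5P; rewrite szr; split.
  - by lia.
  - by apply/allP => y; rewrite mem_cat => /orP[/mem_take|/mem_drop]; exact: Qp.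
  - apply/(sortedP x0) => k; rewrite szr => lt_k; rewrite !nthr.
    case: (ltnP k.+1 i.+1) => ki; first by rewrite ltnW //; apply: srt_p; lia.
    case: (ltnP k i.+1) => ki'.
      by have -> : k = i by [lia]; rewrite subnn addn0.
    by rewrite subSn // addnS; apply: srt_p; lia.
  - by rewrite nthr.
  - rewrite nthr; case: ltnP => [|_]; first by lia.
    by have -> : j + ((i.+1 + (size p - j)).-1 - i.+1) = (size p).-1 by lia.
exists p; split=> // [|i lt_i]; last by rewrite headA ?lastB.
(* If a vertex occurs at [i] and again at [j], then [j] is not last by [lastB], and the vertex after
   [j] would be a forbidden neighbour of the one at [i]. *)
have diff i j : i < j < size p -> nth x0 p i <> nth x0 p j.
  move=> /andP[lt_ij lt_j] E.
  have := lastB j lt_j; rewrite -E lastB; last by lia.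
  case: (ltnP j.+1 (size p)) => [lt_j1 _|]; last by lia.
  have /esym : adj (nth x0 p i) (nth x0 p j.+1) = (j.+1 == i.+1) by apply: ip; lia.
  by rewrite E ip ?eqxx; lia.
apply/(uniqP x0) => i j; rewrite !inE => lt_i lt_j E.
case: (ltngtP i j) => // ij; first by case: (diff i j); rewrite ?ij.
by case: (diff j i); rewrite ?ij.
Qed.

Lemma induced_path_ends (G : sgraph) (x0 u v : G) (w : seq G) :
  0 < size w -> induced_path x0 w -> ~~ adj u v ->
  (forall i, i < size w -> adj u (nth x0 w i) = (i == 0)) ->
  (forall i, i < size w -> adj v (nth x0 w i) = (i.+1 == size w)) ->
  induced_path x0 (u :: rcons w v).
Proof.
move=> w_gt0 ip_w uNv uw vw [|i] [|j] //=; rewrite size_rcons.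
  rewrite ltnS => lt_j; rewrite nth_rcons; case: ltnP => jw; first by rewrite uw.
  have -> : j == size w by lia.
  by rewrite (negPf uNv); lia.
move=> /andP[lt_ij lt_j]; rewrite !nth_rcons.
have -> : i < size w by lia.
case: ltnP => jw; first by rewrite ip_w //; lia.
have -> : j == size w by lia.
by rewrite adj_sym vw; lia.
Qed.

Lemma within_nth (G : sgraph) (x0 : G) (Q : {set G}) (w : seq G) (i j : nat) :
  induced_path x0 w -> i <= j < size w ->
  (forall k, i <= k <= j -> nth x0 w k \in Q) ->
  within Q (nth x0 w i) (nth x0 w j).
Proof.
move=> ip_w; elim: j => [|j IHj]; first by rewrite leqn0 => /andP[/eqP-> _] _; exact: connect0.
rewrite leq_eqVlt => /andP[/orP[/eqP->|lt_ij] lt_j] Qw; first exact: connect0.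
apply: connect_trans (connect1 _).
  by apply: IHj => [|k]; [lia | move=> Hk; apply: Qw; lia].
by rewrite !Qw ?ip_w ?eqxx //; lia.
Qed.

Lemma nth_eq (G : sgraph) (x0 : G) (w : seq G) (i j : nat) :
  uniq w -> i < size w -> j < size w -> (nth x0 w i == nth x0 w j) = (i == j).
Proof. by move=> Uw lt_i lt_j; exact: nth_uniq. Qed.

(** * Prime apple-free graphs: no induced K_{2,3}, and covered neighbourhoods *)

Definition stable3 (G : sgraph) (s1 s2 s3 : G) : bool :=
  [&& s1 != s2, s1 != s3, s2 != s3, ~~ adj s1 s2, ~~ adj s1 s3 & ~~ adj s2 s3].

Definition homogeneous (G : sgraph) (M : {set G}) : Prop :=
  forall x y t : G, x \in M -> y \in M -> t \notin M -> adj t x = adj t y.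

Definition prime_graph (G : sgraph) : Prop :=
  forall M : {set G}, homogeneous M -> 1 < #|M| -> M = setT.

Definition boundary (G : sgraph) (X : {set G}) : {set G} :=
  [set y | (y \notin X) && [exists x in X, adj x y]].

(** An empty boundary is a clique too, so this includes connectedness. *)
Definition clique_cutset_free (G : sgraph) : Prop :=
  forall X : {set G}, X != set0 -> clique (boundary X) ->
    X :|: boundary X = setT.

Definition antinbhd (G : sgraph) (d : G) : {set G} :=
  [set r | (r != d) && ~~ adj d r].

(** The banner is the apple on a 4-cycle: the hole is [a], [b], [c], [d], with [z] pendant at
    [a]. *)
Lemma bannerF (G : sgraph) (a b c d z : G) : apple_free G ->
  adj a b -> adj b c -> adj c d -> adj d a ->
  ~~ adj a c -> ~~ adj b d -> b != d ->
  adj z a -> ~~ adj z b -> ~~ adj z c -> ~~ adj z d -> False.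
Proof.
move=> afG ab bc cd da aNc bNd b_d za zNb zNc zNd.
have neq (x y : G) : adj x y -> (x == y) = false.
  by move=> xy; apply/eqP => E; rewrite E adj_irrefl in xy.
apply: (@hole_pendantF G a a z [:: b; c; d] afG) => //.
- rewrite /= !inE (neq _ _ ab) (neq _ _ bc) (neq _ _ cd) (negPf b_d).
  rewrite [a == d]eq_sym (neq _ _ da) !orbF /= andbT.
  by apply/eqP => ac; rewrite -ac za in zNc.
- by move=> [|[|i]] [|[|[|j]]] //=; rewrite ?bc ?cd ?(negPf bNd) ?andbF.
- by move=> [|[|[|i]]] //=; rewrite ?ab ?(negPf aNc) // adj_sym da.
- by move=> y; rewrite !inE => /or3P[]/eqP->.
Qed.

(* [lia] is exponentially slow on the boolean hypotheses cleared here. *)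
Ltac nlia :=
  repeat match goal with
  | H : context [@adj] |- _ => clear H
  | H : context [@in_mem] |- _ => clear H
  end; lia.

Section Prime.

Variable G : sgraph.
Hypotheses (afG : apple_free G) (prG : prime_graph G).

(** The homogeneous set [Q] built below contains [d1] and [d2] but not [s1], against primality. *)
Lemma no_K23 (d1 d2 s1 s2 s3 : G) : d1 != d2 -> ~~ adj d1 d2 ->
  stable3 s1 s2 s3 ->
  adj d1 s1 -> adj d1 s2 -> adj d1 s3 -> adj d2 s1 -> adj d2 s2 -> adj d2 s3 ->
  False.
Proof.
move=> d12 d1Nd2 /and5P[s12 s13 s23 s1N2 /andP[s1N3 s2N3]] d11 d12' d13 d21 d22 d23.
(* The component Q of d1 in the complement of G[D] is homogeneous. *)
pose D := [set y | [&& adj y s1, adj y s2 & adj y s3]].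
pose e x y := [&& x \in D, y \in D, x != y & ~~ adj x y].
have e_sym : symmetric e.
  by move=> x y; rewrite /e andbCA eq_sym adj_sym.
pose Q := [set y | connect e d1 y].
have d1D : d1 \in D by rewrite inE d11 d12'.
have d2D : d2 \in D by rewrite inE d21 d22.
have QD y : y \in Q -> y \in D.
  rewrite inE => /connectP[p]; elim: p d1 d1D {Q d1Nd2 d12 d11 d12' d13} => [|z p IHp] x xD /=.
    by move=> _ ->.
  by case/andP => /and4P[_ zD _ _] pz yE; exact: IHp pz yE.
have split t y y' : t \notin Q -> y \in Q -> e y y' -> adj t y -> adj t y'.
  move=> tQ yQ yy' ty; apply: contraT => tNy'.
  have y'Q : y' \in Q by rewrite !inE in yQ *; exact: connect_trans yQ (connect1 yy').
  case/and4P: (yy') => yD y'D neq_yy' yNy'.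
  case: (boolP (t \in D)) => [tD|].
    case/negP: (tQ); move: (y'Q); rewrite !inE => cy'.
    apply: connect_trans cy' (connect1 _); rewrite /e y'D tD adj_sym tNy' andbT.
    by apply/eqP => E; rewrite -E y'Q in tQ.
  move: yD y'D; rewrite !inE => /and3P[y1 y2 y3] /and3P[y'1 y'2 y'3].
  (* By [two], [t] sees one of any two of the triple, else it is pendant at [y] on a 4-hole through
     [y']. By [all3], if it sees two it sees the third, else the third is pendant at [y'] on a
     4-hole through [t]. So [t] would be in [D]. *)
  have two s s' : s != s' -> ~~ adj s s' -> adj y s -> adj y s' -> adj y' s -> adj y' s' ->
      adj t s || adj t s'.
    move=> ss' sNs' ys ys' y's y's'; apply: contraT; rewrite negb_or => /andP[ts ts'].
    by case: (bannerF (a := y) (b := s) (c := y') (d := s') (z := t) afG); rewrite // adj_sym.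
  have all3 s s' s'' : s' != s'' -> ~~ adj s s' -> ~~ adj s s'' -> ~~ adj s' s'' ->
      adj y' s -> adj y' s' -> adj y' s'' -> adj t s' -> adj t s'' -> adj t s.
    move=> ss' sNs' sNs'' s'Ns'' y's y's' y's'' ts' ts''; apply: contraT => ts.
    by case: (bannerF (a := y') (b := s') (c := t) (d := s'') (z := s) afG) => //; rewrite adj_sym.
  have := two _ _ s12 s1N2 y1 y2 y'1 y'2.
  have := two _ _ s13 s1N3 y1 y3 y'1 y'3.
  have := two _ _ s23 s2N3 y2 y3 y'2 y'3.
  have s21 : ~~ adj s2 s1 by rewrite adj_sym.
  have s31 : ~~ adj s3 s1 by rewrite adj_sym.
  have s32 : ~~ adj s3 s2 by rewrite adj_sym.
  have := all3 s1 s2 s3 s23 s1N2 s1N3 s2N3 y'1 y'2 y'3.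
  have := all3 s2 s1 s3 s13 s21 s2N3 s1N3 y'2 y'1 y'3.
  have := all3 s3 s1 s2 s12 s31 s32 s1N2 y'3 y'1 y'2.
  by case: (adj t s1); case: (adj t s2); case: (adj t s3) => //=; auto.
have homQ : homogeneous Q.
  suff hom y t : y \in Q -> t \notin Q -> adj t d1 = adj t y.
    by move=> x y t xQ yQ tQ; rewrite -(hom x) // -(hom y).
  move=> yQ tQ; have: d1 \in Q by rewrite inE connect0.
  move: yQ; rewrite inE => /connectP[p].
  elim: p (d1) => [|z p IHp] x /=; first by move=> _ ->.
  case/andP => xz pz yE xQ.
  have zQ : z \in Q by rewrite !inE in xQ *; exact: connect_trans xQ (connect1 xz).
  by rewrite -(IHp z) //; apply/idP/idP; apply: split => //; rewrite e_sym.
have /(prG homQ) QT : 1 < #|Q|.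
  have <- : #|[set d1; d2]| = 2 by rewrite cards2 d12.
  apply: subset_leq_card; apply/subsetP => y; rewrite !inE => /orP[]/eqP-> //.
  by apply: connect1; rewrite /e d1D d2D d12.
have : s1 \in D by apply: QD; rewrite QT inE.
by rewrite inE adj_irrefl.
Qed.

Lemma nbhd_cover (d u v y p q : G) :
  adj d u -> adj d v -> u != v -> ~~ adj u v ->
  p \in antinbhd d -> adj u p -> adj v q -> within (antinbhd d) p q ->
  adj d y -> [|| y == u, y == v, adj y u | adj y v].
Proof.
move=> du dv uv uNv pA up vq pq dy.
apply: contraT; rewrite !negb_or => /and4P[yu yv yNu yNv]; exfalso.
have uNy : ~~ adj u y by rewrite adj_sym.
have vNy : ~~ adj v y by rewrite adj_sym.
have st_uvy : stable3 u v y.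
  by rewrite /stable3 uv eq_sym yu eq_sym yv uNv uNy vNy.
(* If [r] sees all three, there is a K_{2,3}; if it sees exactly two, there is a banner with the
   third pendant at [d]. *)
have one s1 s2 s3 r : stable3 s1 s2 s3 -> adj d s1 -> adj d s2 -> adj d s3 ->
    r \in antinbhd d -> adj s1 r -> adj s2 r -> False.
  move=> st d1 d2 d3; rewrite inE => /andP[rd dNr] s1r s2r.
  case: (boolP (adj s3 r)) => [s3r|s3Nr].
    by apply: (no_K23 (d1 := d) (d2 := r) _ dNr st) => //; rewrite 1?eq_sym // adj_sym.
  case/and5P: st => s12 _ _ s1N2 /andP[s1N3 s2N3].
  by apply: (bannerF (a := d) (b := s1) (c := r) (d := s2) (z := s3) afG); rewrite // adj_sym.
(* A vertex of antinbhd d sees at most one of u, v, y, so the shortest path from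
   N(u) to N(v) or N(y) avoids the neighbours of one of v and y. *)
have [w [w_gt0 wA Uw ip_w uvy_w]] :=
  shortest_path d pA pq up (B := fun r => adj v r || adj y r) (introT orP (or_introl vq)).
(* [s] is where the path arrives: [d], [u], the path and [s] form a hole on which [s'] is pendant at
   [d]. *)
have close s s' : stable3 u s s' -> adj d s -> adj d s' ->
    (forall i, i < size w -> adj s (nth d w i) = (i.+1 == size w)) ->
    {in w, forall r, ~~ adj s' r} -> False.
  case/and5P => us us' ss' uNs /andP[uNs' sNs'] ds ds' sw s'w.
  apply: (@hole_pendantF G d d s' (u :: rcons w s) afG).
  - by rewrite /= size_rcons !ltnS.
  - have out r : adj d r -> r \notin w.
      by move=> dr; apply/negP => /wA; rewrite inE dr andbF.
    have dN r : adj d r -> d != r by move=> dr; apply/eqP => E; rewrite -E adj_irrefl in dr.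
    have dNw : d \notin w by apply/negP => /wA; rewrite inE eqxx.
    by rewrite !cons_uniq rcons_uniq !inE !mem_rcons !inE !negb_or us Uw dNw !dN ?out.
  - by apply: induced_path_ends => // i lt_i; have [] := uvy_w _ lt_i.
  - move=> [|i]; rewrite /= size_rcons ?du // => lt_i; rewrite nth_rcons.
    case: ltnP => iw; last by have -> : i == size w by [nlia]; rewrite ds; nlia.
    have := wA _ (mem_nth d iw); rewrite inE => /andP[_ /negPf->]; nlia.
  - by rewrite adj_sym.
  - move=> r; rewrite inE mem_rcons inE => /or3P[/eqP->|/eqP->|/s'w //]; by rewrite adj_sym.
have lt_last : (size w).-1 < size w by nlia.
have := uvy_w _ lt_last; rewrite prednK // eqxx => -[_ /orP[vl|yl]].
  have Nyl : ~~ adj y (nth d w (size w).-1).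
    apply/negP => yl; apply: (one v y u (nth d w (size w).-1)) => //.
      by rewrite /stable3 eq_sym yv eq_sym uv yu vNy adj_sym uNv yNu.
    by apply: wA; exact: mem_nth.
  apply: (close v y) => //.
    move=> i lt_i; have [_] := uvy_w _ lt_i; case: eqP => [iE _|_ /negbT]; last by rewrite negb_or => /andP[/negPf].
    by have -> : i = (size w).-1 by nlia.
  move=> r /(nthP d)[i lt_i <-]; have [_] := uvy_w _ lt_i.
  case: eqP => [iE _|_ /negbT]; last by rewrite negb_or => /andP[].
  by have -> : i = (size w).-1 by nlia.
have Nvl : ~~ adj v (nth d w (size w).-1).
  apply/negP => vl; apply: (one v y u (nth d w (size w).-1)) => //.
    by rewrite /stable3 eq_sym yv eq_sym uv yu vNy adj_sym uNv yNu.
  by apply: wA; exact: mem_nth.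
apply: (close y v) => //.
- by rewrite /stable3 eq_sym yu uv yv uNy uNv yNv.
- move=> i lt_i; have [_] := uvy_w _ lt_i; case: eqP => [iE _|_ /negbT]; last by rewrite negb_or => /andP[_ /negPf].
  by have -> : i = (size w).-1 by nlia.
- move=> r /(nthP d)[i lt_i <-]; have [_] := uvy_w _ lt_i.
  case: eqP => [iE _|_ /negbT]; last by rewrite negb_or => /andP[].
  by have -> : i = (size w).-1 by nlia.
Qed.

End Prime.

(** * Crossings and their existence *)

Definition cnbhd (G : sgraph) (x : G) : {set G} := [set y | (y == x) || adj x y].

Lemma cnbhd_sym (G : sgraph) (x y : G) : (y \in cnbhd x) = (x \in cnbhd y).
Proof. by rewrite !inE eq_sym adj_sym. Qed.

Lemma antinbhdE (G : sgraph) (x y : G) : (y \in antinbhd x) = (y \notin cnbhd x).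
Proof. by rewrite !inE negb_or. Qed.

(* d, u, p, .., q, v is a hole; the last two conditions record what is needed to
   apply [nbhd_cover] at u with p, and at v with q. *)
Definition crossing (G : sgraph) (d u v p q : G) : Prop :=
  [/\ [&& adj d u, adj d v, u != v & ~~ adj u v],
      [&& p \in antinbhd d, adj u p, adj v q & within (antinbhd d) p q],
      exists2 r, r \in antinbhd u & adj p r && within (antinbhd u) r v &
      exists2 r, r \in antinbhd v & adj q r && within (antinbhd v) r u].

Lemma crossing_sym (G : sgraph) (d u v p q : G) :
  crossing d u v p q -> crossing d v u q p.
Proof.
case=> /and4P[du dv uv uNv] /and4P[pA up vq pq] ru rv; split=> //.
  by rewrite du dv eq_sym uv adj_sym uNv.
by rewrite (within_mem pq) // vq up within_sym.
Qed.

(** Vertices of an induced path at index distance at least 2 are nonadjacent. So indices 2 to [j]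
    avoid the closed neighbourhood of vertex 0, and indices 0 to [j.-2] that of vertex [j], as the
    last two conditions ask. *)
Lemma crossing_nth (G : sgraph) (x0 d : G) (w : seq G) (j : nat) :
  uniq w -> induced_path x0 w -> 1 < j < size w ->
  adj d (nth x0 w 0) -> adj d (nth x0 w j) ->
  (forall i, 0 < i < j -> nth x0 w i \in antinbhd d) ->
  crossing d (nth x0 w 0) (nth x0 w j) (nth x0 w 1) (nth x0 w j.-1).
Proof.
move=> Uw ip_w /andP[j_gt1 lt_j] d0 dj dN.
have far i k : i.+1 < k < size w -> nth x0 w k \in antinbhd (nth x0 w i).
  by move=> Hik; rewrite inE nth_eq ?ip_w //; lia.
have far' i k : i.+1 < k < size w -> nth x0 w i \in antinbhd (nth x0 w k).
  by move=> Hik; rewrite inE adj_sym nth_eq ?ip_w //; lia.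
split.
- by rewrite d0 dj nth_eq ?ip_w //; lia.
- rewrite dN ?(ip_w 0 1) //=; last by lia.
  have -> /= : adj (nth x0 w j) (nth x0 w j.-1).
    by rewrite adj_sym ip_w; lia.
  apply: within_nth => //; first by lia.
  by move=> k Hk; apply: dN; lia.
- exists (nth x0 w 2); first by apply: far; lia.
  rewrite ip_w /=; last by lia.
  by apply: within_nth => [||k Hk] //; [lia | apply: far; lia].
- exists (nth x0 w j.-2); first by apply: far'; lia.
  have -> /= : adj (nth x0 w j.-1) (nth x0 w j.-2).
    by rewrite adj_sym ip_w; lia.
  rewrite within_sym; apply: within_nth => [||k Hk] //; first by lia.
  by apply: far'; lia.
Qed.

Section Structure.

Variable G : sgraph.
Hypotheses (afG : apple_free G) (prG : prime_graph G).
Hypothesis ccfG : clique_cutset_free G.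

Lemma crossing_cover (d u v p q y : G) :
  crossing d u v p q -> y \in cnbhd d -> y \in cnbhd u :|: cnbhd v.
Proof.
case=> /and4P[du dv uv uNv] /and4P[pA up vq pq] _ _.
rewrite !inE => /orP[/eqP->|dy]; first by rewrite adj_sym du orbT.
have := nbhd_cover afG prG du dv uv uNv pA up vq pq dy.
by rewrite (adj_sym y u) (adj_sym y v) => /or4P[]->; rewrite ?orbT.
Qed.

Lemma exists_crossing (A : {set G}) (s1 s2 s3 d0 : G) :
  stable3 s1 s2 s3 -> s1 \in A -> s2 \in A -> s3 \in A -> A \subset cnbhd d0 ->
  exists d u v p q, [/\ crossing d u v p q, A \subset cnbhd d,
    ~~ (A \subset cnbhd u) & ~~ (A \subset cnbhd v)].
Proof.
move=> st A1 A2 A3 Ad0; have [s12 s13 s23 s1N2 _] := and5P st.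
(* D is a clique, so a component X of ~: M attaches to two nonadjacent vertices of
   M. A path through X joining them leaves N(d) for some d in D, and the first
   excursion outside N(d) is the required hole; its ends are not in D. *)
pose D := [set y | A \subset cnbhd y]; pose M := [set m | D \subset cnbhd m].
have D_A y a : y \in D -> a \in A -> (a == y) || adj y a.
  by rewrite inE => /subsetP yA /yA; rewrite inE.
(* Two distinct nonadjacent members of [D] would lie outside [A], hence be complete to the stable
   triple and give a K_{2,3}. *)
have cD y y' : y \in D -> y' \in D -> y' \in cnbhd y.
  move=> yD y'D; apply: contraT; rewrite inE negb_or => /andP[y'y yNy']; exfalso.
  have yA : y \notin A.
    by apply/negP => /(D_A _ _ y'D); rewrite eq_sym (negPf y'y) adj_sym (negPf yNy').
  have y'A : y' \notin A by apply/negP => /(D_A _ _ yD); rewrite (negPf y'y) (negPf yNy').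
  have adA z s : z \in D -> z \notin A -> s \in A -> adj z s.
    move=> zD zA sA; case/orP: (D_A _ _ zD sA) => // /eqP E.
    by rewrite E (negPf zA) in sA.
  by apply: (no_K23 afG prG (d1 := y) (d2 := y') _ yNy' st); rewrite ?adA // eq_sym.
have MP m y : m \in M -> y \in D -> y \in cnbhd m by rewrite inE => /subsetP mD /mD.
have AM a : a \in A -> a \in M.
  by move=> aA; rewrite inE; apply/subsetP => y yD; rewrite cnbhd_sym inE D_A.
have DM y : y \in D -> y \in M.
  by move=> yD; rewrite inE; apply/subsetP => y' y'D; exact: cD.
have d0D : d0 \in D by rewrite inE.
(* Otherwise [d0] is adjacent to all other vertices, and these form a homogeneous set, against
   primality. *)
have [x xM] : exists x, x \notin M.
  apply/existsP; apply: contraT; rewrite negb_exists => /forallP MT; exfalso.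
  have hom : homogeneous [set~ d0].
    move=> a b t; rewrite !inE negbK => ad0 bd0 /eqP->.
    have ad z : z != d0 -> adj d0 z.
      move=> zd0; have := MT z; rewrite negbK => /MP/(_ d0D).
      by rewrite inE eq_sym (negPf zd0) adj_sym.
    by rewrite !ad.
  have /(prG hom) /setP/(_ d0) : 1 < #|[set~ d0]|.
    rewrite cardsC1; suff : 2 < #|G| by nlia.
    rewrite -cardsT; apply/card_gt2P; exists s1, s2, s3.
    by rewrite !inE s12 s23 eq_sym s13.
  by rewrite !inE eqxx.
pose R := ~: M; pose X := [set y | within R x y].
have xR : x \in R by rewrite in_setC.
have XR y : y \in X -> y \in R by rewrite inE => /within_mem; apply.
have bdM y : y \in boundary X -> y \in M.
  rewrite inE => /andP[yX /existsP[x' /andP[x'X x'y]]]; apply: contraT => yM.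
  have [x'R yR] : x' \in R /\ y \in R by rewrite XR ?in_setC.
  case/negP: yX; rewrite inE; rewrite inE in x'X.
  by apply: connect_trans x'X (connect1 _); rewrite x'R yR.
have inbd s : s \in A -> X :|: boundary X = setT -> s \in boundary X.
  move=> sA /setP/(_ s); rewrite in_setU in_setT => /orP[/XR|//].
  by rewrite in_setC AM.
have X0 : X != set0 by apply/set0Pn; exists x; rewrite inE; exact: connect0.
(* If the boundary were a clique, it would cover everything together with [X]; then [s1] and [s2],
   which are in [M], would be nonadjacent vertices of the boundary. *)
have [u [v [uB vB uv uNv]]] : exists u v,
    [/\ u \in boundary X, v \in boundary X, u != v & ~~ adj u v].
  case: (boolP [exists u in boundary X, [exists v in boundary X, (u != v) && ~~ adj u v]]).
    by move=> /existsP[u /andP[uB /existsP[v /and3P[vB uv uNv]]]]; exists u, v.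
  move=> noUV; have cX : clique (boundary X).
    move=> u v uB vB uv; apply: contraT => uNv; case/negP: noUV.
    by apply/existsP; exists u; rewrite uB; apply/existsP; exists v; rewrite vB uv.
  have XT := ccfG X0 cX.
  by case/negP: s1N2; apply: cX => //; apply: inbd.
have [uM vM] : u \in M /\ v \in M by rewrite !bdM.
have [a aX ua] : exists2 a, a \in X & adj u a.
  by move: uB; rewrite inE => /andP[_ /existsP[a /andP[aX au]]]; exists a; rewrite // adj_sym.
have [b bX vb] : exists2 b, b \in X & adj v b.
  by move: vB; rewrite inE => /andP[_ /existsP[b /andP[bX bv]]]; exists b; rewrite // adj_sym.
have ab : within R a b.
  by rewrite !inE in aX bX; apply: connect_trans bX; rewrite [connect _ _ _]within_sym.
have [w [w_gt0 wR Uw ip_w uv_w]] := shortest_path u (XR _ aX) ab ua vb.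
have wM y : y \in w -> y \notin M by move=> /wR; rewrite in_setC.
have ip_W : induced_path u (u :: rcons w v).
  by apply: induced_path_ends => // i lt_i; have [] := uv_w _ lt_i.
have U_W : uniq (u :: rcons w v).
  rewrite cons_uniq rcons_uniq mem_rcons inE negb_or uv Uw andbT /=.
  by apply/andP; split; apply/negP => /wM; rewrite ?uM ?vM.
have p_w : nth u w 0 \in w by exact: mem_nth.
have [d dD dNp] : exists2 d, d \in D & nth u w 0 \in antinbhd d.
  have := wM _ p_w; rewrite inE => /subsetPn[d dD dNp]; exists d => //.
  by rewrite antinbhdE cnbhd_sym.
have notD z z' : z \in M -> z' \in M -> z != z' -> ~~ adj z z' -> z \notin D.
  move=> zM z'M zz' zNz'; apply/negP => /(MP _ _ z'M).
  by rewrite inE (negPf zz') adj_sym (negPf zNz').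
have uD : u \notin D by exact: notD uM vM uv uNv.
have vD : v \notin D by apply: notD vM uM _ _; rewrite 1?eq_sym // adj_sym.
have dM z : z \in M -> z \notin D -> adj d z.
  move=> zM zD; have := MP _ _ zM dD; rewrite inE adj_sym => /orP[/eqP dz|//].
  by rewrite -dz dD in zD.
have has_d : has (adj d) (rcons w v) by rewrite has_rcons dM.
(* The first return to the neighbourhood of [d] after [u]. It exists because [v] is in [M] but not
   in [D]; it is not at 0 because [d] misses that vertex. In [u :: rcons w v] its index is
   [j.+1]. *)
pose j := find (adj d) (rcons w v).
have j_lt : j < (size w).+1 by rewrite -(size_rcons w v) -has_find.
have j_gt0 : 0 < j.
  rewrite lt0n; apply/eqP => j0; have := nth_find u has_d; rewrite -/j j0 nth_rcons w_gt0.
  by move: dNp; rewrite inE => /andP[_ /negPf->].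
have cr : crossing d u (nth u (rcons w v) j) (nth u w 0) (nth u (rcons w v) j.-1).
  have := @crossing_nth G u d (u :: rcons w v) j.+1 U_W ip_W.
  rewrite /= size_rcons !ltnS j_gt0 (j_lt : j <= size w) [nth u (rcons w v) 0]nth_rcons w_gt0.
  have -> : nth u (u :: rcons w v) j = nth u (rcons w v) j.-1 by case: (j) j_gt0.
  apply=> //; [exact: dM | exact: (nth_find u has_d)|].
  move=> [|i] //= /ltnSE lt_ij; rewrite inE (before_find u lt_ij) andbT.
  rewrite nth_rcons; have -> : i < size w by nlia.
  apply/eqP => E; have iw : i < size w by nlia.
  by have := wM _ (mem_nth u iw); rewrite E DM.
exists d, u, (nth u (rcons w v) j), (nth u w 0), (nth u (rcons w v) j.-1).
split=> //; try by rewrite !inE in dD uD *.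
suff : nth u (rcons w v) j \notin D by rewrite inE.
rewrite nth_rcons; case: ltnP => [jw|jw]; last by have -> : j == size w by nlia.
by apply/negP => /DM; apply/negP/wM/mem_nth.
Qed.

End Structure.

(** * Cuts described by boundedly many vertices, and the recursion on stable triples *)

(** Only [K] is confined to [A]; [S] ranges over the whole graph, so families for several sets [A]
    can simply be united. *)
Definition cuts_off (G : sgraph) (A : {set G}) (F : {set {set G}}) : Prop :=
  forall K S : {set G}, clique K -> stable S -> [disjoint K & S] -> K \subset A ->
    exists2 W, W \in F & (K \subset W) && [disjoint W & S].

(* Indexes the sets of at most 8 vertices by a type of polynomial size. *)
Definition few (G : sgraph) (e : {ffun 'I_8 -> option G}) : {set G} :=
  [set y | [exists i, e i == Some y]].

Lemma few_onto (G : sgraph) (E : {set G}) : #|E| <= 8 -> exists e, few e = E.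
Proof.
move=> E8; exists [ffun i : 'I_8 => nth None [seq Some y | y <- enum E] i].
apply/setP => y; rewrite inE -mem_enum; apply/existsP/idP => [[i]|yE].
  rewrite ffunE; case: (ltnP i (size (enum E))) => lt_i.
    by rewrite (nth_map y) // => /eqP[<-]; exact: mem_nth.
  by rewrite nth_default ?size_map.
have lt_y : index y (enum E) < 8.
  by apply: leq_trans E8; rewrite cardE index_mem.
exists (Ordinal lt_y); rewrite ffunE /= (nth_map y) ?index_mem //.
by rewrite nth_index.
Qed.

(* With U = N[u] and V = N[v], the options o1 and o2 hold vertices of S that see
   only u, respectively only v, and E is a set of exceptions contained in S. *)
Definition trim (G : sgraph) (A U V E : {set G}) (o1 o2 : option G) : {set G} :=
  [set y in A | [&& y \notin E,
    (y \in U :\: V) ==> oapp (@adj G y) true o1 &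
    (y \in V :\: U) ==> oapp (@adj G y) true o2]].

Definition trims (G : sgraph) (A U V : {set G}) : {set {set G}} :=
  [set trim A U V (few x.1.1) x.1.2 x.2 |
    x : {ffun 'I_8 -> option G} * option G * option G].

(** Ten choices from [option G]: eight for the exceptions, two for [o1] and [o2]. *)
Lemma card_trims (G : sgraph) (A U V : {set G}) : #|trims A U V| <= #|G|.+1 ^ 10.
Proof.
apply: leq_trans (leq_imset_card _ _) _.
rewrite !card_prod card_ffun card_ord card_option.
by rewrite -!expnSr.
Qed.

(** All of [S :&: A] fits into the exceptions; with [None] for both options, whose default is
    [true], the cut is [A] minus [S]. *)
Lemma trims_small (G : sgraph) (A U V K S : {set G}) :
  [disjoint K & S] -> K \subset A -> #|S :&: A| <= 8 ->
  exists2 W, W \in trims A U V & (K \subset W) && [disjoint W & S].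
Proof.
move=> KS KA /few_onto[e eE]; exists (trim A U V (few e) None None).
  by apply/imsetP; exists (e, None, None).
apply/andP; split.
  apply/subsetP => k kK; rewrite inE (subsetP KA) // eE !implybT inE negb_and.
  by rewrite (disjointFr KS).
rewrite -setI_eq0; apply/eqP/setP => s.
rewrite in_set0 in_setI [_ \in trim _ _ _ _ _ _]inE eE in_setI.
by case: (s \in A); case: (s \in S); rewrite ?andbF.
Qed.

Definition triples (G : sgraph) (A : {set G}) : {set G * G * G} :=
  [set t | [&& t.1.1 \in A, t.1.2 \in A, t.2 \in A & stable3 t.1.1 t.1.2 t.2]].

(** The products of the two parts sum to at most [a.-1 * t]. The [2 * t] gained over [2 * (a * t)]
    pays for the two extra units [Q], as [t] is positive. *)
Lemma split_count (Q t tu tv a au av fu fv f g : nat) :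
  au < a -> av < a -> tu + tv <= t -> 0 < t ->
  fu <= Q * (1 + 2 * (au * tu)) -> fv <= Q * (1 + 2 * (av * tv)) -> g <= Q ->
  f <= fu + fv + g -> f <= Q * (1 + 2 * (a * t)).
Proof.
move=> leu lev Tuv t_gt0 fu_le fv_le g_le f_le.
apply: leq_trans f_le _; apply: leq_trans (leq_add (leq_add fu_le fv_le) g_le) _.
rewrite -{3}[Q]muln1 -!mulnDr leq_mul2l; apply/orP; right.
have lu : au * tu <= a.-1 * tu by apply: leq_mul => //; lia.
have lv : av * tv <= a.-1 * tv by apply: leq_mul => //; lia.
have luv : a.-1 * tu + a.-1 * tv <= a.-1 * t by rewrite -mulnDr leq_mul2l Tuv orbT.
have -> : a * t = a.-1 * t + t by rewrite addnC -mulSn prednK //; lia.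
lia.
Qed.

Section Recursion.

Variable G : sgraph.
Hypotheses (afG : apple_free G) (prG : prime_graph G).
Hypothesis ccfG : clique_cutset_free G.

Lemma triple_of_stable (S : {set G}) : stable S -> 2 < #|S| ->
  exists s1 s2 s3, [/\ s1 \in S, s2 \in S, s3 \in S & stable3 s1 s2 s3].
Proof.
move=> stS /card_gt2P[s1 [s2 [s3 [[s1S s2S s3S] [s12 s23 s31]]]]].
exists s1, s2, s3; split=> //.
by rewrite /stable3 s12 [s1 == _]eq_sym s31 s23 !stS.
Qed.

Lemma common_stable_le2 (d1 d2 : G) (S : {set G}) : d1 != d2 -> ~~ adj d1 d2 ->
  stable S -> #|[set s in S | adj d1 s && adj d2 s]| <= 2.
Proof.
move=> d12 d1Nd2 stS; rewrite leqNgt; apply/negP => /triple_of_stable[].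
  by move=> x y; rewrite !inE => /andP[xS _] /andP[yS _]; exact: stS.
move=> s1 [s2 [s3 []]]; rewrite !inE => /and3P[_ ? ?] /and3P[_ ? ?] /and3P[_ ? ?] st.
by apply: (no_K23 afG prG d12 d1Nd2 st).
Qed.

(** If [k1] sees [p], it can replace [u] on the hole, and [nbhd_cover] at [d] applies to [s].
    Otherwise [k1] and [p] are nonadjacent neighbours of [u], joined outside its closed
    neighbourhood through [k2], [v] and [r], and [nbhd_cover] at [u] applies to [s]. *)
Lemma crossing_adj (d u v p q k1 k2 s : G) : crossing d u v p q ->
  adj d k1 -> adj u k1 -> k1 \notin cnbhd v -> k2 \notin cnbhd u -> adj v k2 ->
  adj k1 k2 -> adj d s -> adj u s -> s \notin cnbhd v -> s != k1 -> ~~ adj p s ->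
  adj k1 s.
Proof.
case=> /and4P[du dv uv uNv] /and4P[pA up vq pq] [r rA /andP[pr rv]] _.
move=> dk1 uk1 k1v k2u vk2 k12 ds us sv sk1 pNs.
have [k1_v vNk1] : k1 != v /\ ~~ adj v k1 by move: k1v; rewrite inE negb_or => /andP[].
have [s_v vNs] : s != v /\ ~~ adj v s by move: sv; rewrite inE negb_or => /andP[].
have [p_d dNp] : p != d /\ ~~ adj d p by move: pA; rewrite inE => /andP[].
case: (boolP (adj k1 p)) => [k1p|k1Np].
  have k1Nv : ~~ adj k1 v by rewrite adj_sym.
  have := nbhd_cover afG prG dk1 dv k1_v k1Nv pA k1p vq pq ds.
  by rewrite (negPf sk1) (negPf s_v) [adj s v]adj_sym (negPf vNs) !orbF adj_sym.
have k1_p : k1 != p by apply/eqP => E; rewrite -E dk1 in dNp.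
have k2A : k2 \in antinbhd u by rewrite antinbhdE.
have vA : v \in antinbhd u by rewrite inE eq_sym uv.
have k2r : within (antinbhd u) k2 r.
  rewrite within_sym in rv; apply: connect_trans rv; apply: connect1.
  by rewrite k2A vA adj_sym.
have := nbhd_cover afG prG uk1 up k1_p k1Np k2A k12 pr k2r us.
rewrite (negPf sk1) [adj s p]adj_sym (negPf pNs) orbF adj_sym /=.
by case/orP => // /eqP E; rewrite -E ds in dNp.
Qed.

(** A single non-exceptional [o1] of [S] that sees only [u] is a test: by [crossing_adj] it is
    adjacent to every vertex of [K] seeing only [u], and it is adjacent to none of [S]. Likewise
    [o2] for [v]. *)
Lemma trims_crossing (A K S : {set G}) (d u v p q : G) :
  crossing d u v p q -> A \subset cnbhd d ->
  clique K -> stable S -> [disjoint K & S] -> K \subset A ->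
  ~~ (K \subset cnbhd u) -> ~~ (K \subset cnbhd v) ->
  exists2 W, W \in trims A (cnbhd u) (cnbhd v) &
    (K \subset W) && [disjoint W & S].
Proof.
move=> cr Ad cK stS KS KA /subsetPn[k2 k2K k2u] /subsetPn[k1 k1K k1v].
have cov y : y \in A -> (y \in cnbhd u) || (y \in cnbhd v).
  by move=> yA; rewrite -in_setU (crossing_cover afG prG cr) // (subsetP Ad).
have half u' v' p' q' (l1 l2 s : G) : crossing d u' v' p' q' ->
    (forall y, y \in A -> (y \in cnbhd u') || (y \in cnbhd v')) ->
    l1 \in K -> l1 \notin cnbhd v' -> l2 \in K -> l2 \notin cnbhd u' ->
    s \in S -> s \in A -> s != u' -> s \notin cnbhd v' -> ~~ adj p' s -> adj l1 s.
  move=> cr' cov' l1K l1v l2K l2u sS sA su sv pNs.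
  have [/and4P[du' dv' _ _] _ _ _] := cr'.
  have adj_of x y z : y \in cnbhd x -> z \in K -> z \notin cnbhd x -> y \in K -> adj x y.
    move=> yx zK zx yK; move: yx; rewrite inE => /orP[/eqP E|//]; case/negP: zx.
    by rewrite inE -E; case: eqP => //= /eqP zy; apply: cK => //; rewrite eq_sym.
  have l1u : l1 \in cnbhd u' by have := cov' _ (subsetP KA _ l1K); rewrite (negPf l1v) orbF.
  have l2v : l2 \in cnbhd v' by have := cov' _ (subsetP KA _ l2K); rewrite (negPf l2u).
  have dAdj y : y \in A -> y \notin cnbhd v' -> adj d y.
    move=> yA yv; have := subsetP Ad _ yA; rewrite inE => /orP[/eqP E|//].
    by move: yv; rewrite E inE adj_sym dv' orbT.
  apply: (crossing_adj cr' (k2 := l2)) => //.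
  - by apply: dAdj => //; exact: (subsetP KA).
  - exact: (adj_of _ _ l2).
  - exact: (adj_of _ _ l1).
  - by apply: cK => //; apply/eqP => E; rewrite -E l1u in l2u.
  - exact: dAdj.
  - have := cov' _ sA; rewrite (negPf sv) orbF inE (negPf su) //.
  - by apply/eqP => E; have := disjointFr KS l1K; rewrite -E sS.
pose E := S :&: A :&: ([set u; v] :|: [set s in S | adj d s && adj p s] :|:
  [set s in S | adj d s && adj q s] :|: [set s in S | adj u s && adj v s]).
have [/and4P[du dv uv uNv] /and4P[pA up vq pq] _ _] := cr.
have qA := within_mem pq pA.
(* Two for [u] and [v], and at most two common neighbours in [S] for each nonadjacent pair [d], [p];
   [d], [q]; [u], [v]. *)
have E8 : #|E| <= 8.
  apply: leq_trans (subset_leq_card (subsetIr _ _)) _.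
  have leU (X Y : {set G}) m n : #|X| <= m -> #|Y| <= n -> #|X :|: Y| <= m + n.
    by move=> Xm Yn; apply: leq_trans (leq_card_setU X Y) _; exact: leq_add.
  move: pA qA; rewrite !inE => /andP[pd dNp] /andP[qd dNq].
  apply: (leU _ _ 6 2); last exact: common_stable_le2.
  apply: (leU _ _ 4 2); last by apply: common_stable_le2; rewrite // eq_sym.
  apply: (leU _ _ 2 2); last by apply: common_stable_le2; rewrite // eq_sym.
  by rewrite cards2; case: (_ != _).
have [e eE] := few_onto E8.
have EN s : s \in S -> s \in A -> s \notin E ->
    [/\ s != u, s != v, ~~ ((s \in cnbhd u) && (s \in cnbhd v)) &
        (s != d) ==> ~~ adj p s && ~~ adj q s].
  move=> sS sA; rewrite !inE sS sA /= !negb_or -!andbA => /and5P[su sv Np Nq Nuv].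
  have ds : s != d -> adj d s.
    by move=> sd; have := subsetP Ad _ sA; rewrite inE (negPf sd).
  rewrite su sv (negPf su) (negPf sv) /= Nuv; split=> //; apply/implyP => /ds ds'.
  by move: Np Nq; rewrite ds' /= => -> ->.
have NdN s : s \notin cnbhd u :&: cnbhd v -> s != d.
  move=> sN; apply/eqP => sd; case/negP: sN; rewrite sd !inE.
  by rewrite (adj_sym u) (adj_sym v) du dv !orbT.
pose o1 := [pick s in S :&: A :\: E | s \in cnbhd u :\: cnbhd v].
pose o2 := [pick s in S :&: A :\: E | s \in cnbhd v :\: cnbhd u].
exists (trim A (cnbhd u) (cnbhd v) (few e) o1 o2).
  by apply/imsetP; exists (e, o1, o2).
apply/andP; split.
  apply/subsetP => k kK; rewrite inE (subsetP KA) //= eE; apply/and3P; split.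
  - by rewrite in_setI in_setI negb_and negb_and (disjointFr KS kK).
  - apply/implyP; rewrite in_setD => /andP[kv ku]; rewrite /o1; case: pickP => //= s.
    rewrite !in_setD in_setI => /andP[/andP[sE /andP[sS sA]] /andP[sv su]].
    have [s_u _ _ /implyP Npq] := EN _ sS sA sE.
    have sd : s != d by apply: NdN; rewrite in_setI negb_and sv orbT.
    by have [pNs _] := andP (Npq sd); apply: (half u v p q k k2 s).
  - apply/implyP; rewrite in_setD => /andP[ku kv]; rewrite /o2; case: pickP => //= s.
    rewrite !in_setD in_setI => /andP[/andP[sE /andP[sS sA]] /andP[su sv]].
    have [_ s_v _ /implyP Npq] := EN _ sS sA sE.
    have sd : s != d by apply: NdN; rewrite in_setI negb_and su.
    have [_ qNs] := andP (Npq sd).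
    apply: (half v u q p k k1 s) => //; first exact: crossing_sym.
    by move=> y yA; rewrite orbC cov.
(* A vertex of [S] left in the cut is no exception, so it sees exactly one of [u], [v]. The matching
   option is then some [t] in [S], to which it would be adjacent. *)
rewrite -setI_eq0; apply/eqP/setP => s; rewrite in_set0; apply/negP.
rewrite in_setI => /andP[]; rewrite inE eE => /and4P[sA sE s1 s2] sS.
have [_ _ Nuv _] := EN _ sS sA sE.
have sX : s \in S :&: A :\: E by rewrite in_setD in_setI sE sS.
case/orP: (cov _ sA) => [su|sv].
  have sv : s \notin cnbhd v by move: Nuv; rewrite su.
  have sO : s \in cnbhd u :\: cnbhd v by rewrite in_setD sv.
  move: s1; rewrite sO /= /o1; case: pickP => [t /andP[]|/(_ s)]; last by rewrite sX sO.
  rewrite in_setD in_setI => /and3P[_ tS _] _ /=; exact/negP/stS.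
have su : s \notin cnbhd u by move: Nuv; rewrite sv andbT.
have sO : s \in cnbhd v :\: cnbhd u by rewrite in_setD su.
move: s2; rewrite sO /= /o2; case: pickP => [t /andP[]|/(_ s)]; last by rewrite sX sO.
rewrite in_setD in_setI => /and3P[_ tS _] _ /=; exact/negP/stS.
Qed.

Lemma cuts_off_cnbhd (A : {set G}) (d0 : G) : A \subset cnbhd d0 ->
  exists2 F : {set {set G}}, cuts_off A F &
    #|F| <= #|G|.+1 ^ 10 * (1 + 2 * (#|A| * #|triples A|)).
Proof.
move: {2}#|A| (leqnn #|A|) => n; elim: n A d0 => [|n IHn] A d0 leAn Ad0.
  exists (trims A A A).
    move=> K S _ _ KS KA; apply: trims_small => //.
    apply: leq_trans (subset_leq_card (subsetIr _ _)) _; exact: leq_trans leAn _.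
  apply: leq_trans (card_trims _ _ _) _; rewrite mulnDr muln1; exact: leq_addr.
case: (set_0Vmem (triples A)) => [T0|[[[s1 s2] s3]]].
  exists (trims A A A); last first.
    by apply: leq_trans (card_trims _ _ _) _; rewrite mulnDr muln1; exact: leq_addr.
  move=> K S _ stS KS KA; apply: trims_small => //; apply: (@leq_trans 2) => //.
  rewrite leqNgt; apply/negP => /triple_of_stable[].
    by move=> x y; rewrite !inE => /andP[xS _] /andP[yS _]; exact: stS.
  move=> s1 [s2 [s3 []]]; rewrite !inE => /andP[_ s1A] /andP[_ s2A] /andP[_ s3A] st.
  by have := in_set0 (s1, s2, s3); rewrite -T0 inE /= s1A s2A s3A st.
move=> t_A; have := t_A; rewrite inE /= => /and4P[s1A s2A s3A st].
have [d [u [v [p [q [cr Ad Au Av]]]]]] :=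
  exists_crossing afG prG ccfG st s1A s2A s3A Ad0.
have small x : ~~ (A \subset cnbhd x) -> #|A :&: cnbhd x| < #|A|.
  move=> Ax; apply: proper_card; rewrite properE subsetIl /=.
  by apply: contra Ax => /subset_trans; apply; exact: subsetIr.
have [|//|Fu Fu_off Fu_card] := IHn (A :&: cnbhd u) d.
- by have := small _ Au; nlia.
- by apply: subset_trans Ad; exact: subsetIl.
have [|//|Fv Fv_off Fv_card] := IHn (A :&: cnbhd v) d.
- by have := small _ Av; nlia.
- by apply: subset_trans Ad; exact: subsetIl.
exists (Fu :|: Fv :|: trims A (cnbhd u) (cnbhd v)).
  move=> K S cK stS KS KA.
  case: (boolP (K \subset cnbhd u)) => [Ku|Ku].
    have [|W WF Wsep] := Fu_off K S cK stS KS; first by rewrite subsetI KA.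
    by exists W; rewrite // !in_setU WF.
  case: (boolP (K \subset cnbhd v)) => [Kv|Kv].
    have [|W WF Wsep] := Fv_off K S cK stS KS; first by rewrite subsetI KA.
    by exists W; rewrite // !in_setU WF orbT.
  have [W WF Wsep] := trims_crossing cr Ad cK stS KS KA Ku Kv.
  by exists W; rewrite // !in_setU WF orbT.
have Tuv : #|triples (A :&: cnbhd u)| + #|triples (A :&: cnbhd v)| <= #|triples A|.
  have TI x : triples (A :&: cnbhd x) \subset triples A.
    apply/subsetP => t; rewrite !inE => /and4P[].
    by move=> /andP[-> _] /andP[-> _] /andP[-> _] ->.
  have I0 : triples (A :&: cnbhd u) :&: triples (A :&: cnbhd v) = set0.
    apply/setP => -[[t1 t2] t3]; rewrite in_set0; apply/negP.
    rewrite in_setI => /andP[]; rewrite inE /= !in_setI.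
    move=> /and4P[/andP[_ u1] /andP[_ u2] /andP[_ u3] stt].
    rewrite inE /= !in_setI => /and4P[/andP[_ v1] /andP[_ v2] /andP[_ v3] _].
    have [/and4P[_ _ uv uNv] _ _ _] := cr.
    (* A vertex in both closed neighbourhoods is neither [u] nor [v], so it is a common neighbour,
       as K_{2,3} requires. *)
    have far x y t : ~~ adj x y -> x != y -> t \in cnbhd x -> t \in cnbhd y -> adj x t.
      move=> xNy xy; rewrite !inE => /orP[/eqP->|//].
      by rewrite (negPf xy) adj_sym (negPf xNy).
    have vNu : ~~ adj v u by rewrite adj_sym.
    have vu : v != u by rewrite eq_sym.
    by apply: (no_K23 afG prG uv uNv stt);
      [exact: far u1 v1|exact: far u2 v2|exact: far u3 v3|
       exact: far v1 u1|exact: far v2 u2|exact: far v3 u3].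
  rewrite -cardsUI I0 cards0 addn0; apply: subset_leq_card.
  by rewrite subUset !TI.
have T_gt0 : 0 < #|triples A| by apply/card_gt0P; exists (s1, s2, s3).
apply: (split_count (small _ Au) (small _ Av) Tuv T_gt0 Fu_card Fv_card
  (card_trims A (cnbhd u) (cnbhd v))).
apply: leq_trans (leq_card_setU _ _) _; rewrite leq_add2r.
exact: leq_card_setU.
Qed.

(** The leading 1 counts [set0], which serves the empty clique; [#|G| ^ 4] bounds the size of a
    closed neighbourhood times the number of its triples. *)
Lemma cuts_off_prime : exists2 F : {set {set G}}, cuts_off [set: G] F &
  #|F| <= 1 + #|G| * (#|G|.+1 ^ 10 * (1 + 2 * #|G| ^ 4)).
Proof.
have [F FP] := fin_all_exists2 (fun x : G => cuts_off_cnbhd (subxx (cnbhd x))).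
move=> F_card; exists (set0 |: \bigcup_x F x).
  move=> K S cK stS KS _; case: (set_0Vmem K) => [->|[x xK]].
    by exists set0; rewrite ?in_setU1 ?eqxx // sub0set -setI_eq0 set0I eqxx.
  have [|W WF Wsep] := FP x K S cK stS KS.
    apply/subsetP => y yK; rewrite inE; case: eqP => //= /eqP yx.
    by apply: cK => //; rewrite eq_sym.
  by exists W; rewrite // in_setU1; apply/orP; right; apply/bigcupP; exists x.
apply: leq_trans (leq_card_setU _ _) _; rewrite cards1 leq_add2l.
apply: leq_trans (_ : \sum_x #|F x| <= _).
  apply: (big_ind2 (fun (X : {set {set G}}) n => #|X| <= n)); rewrite ?cards0 //.
  move=> X m Y n Xm Yn; apply: leq_trans (leq_card_setU X Y) _; exact: leq_add.
rewrite -sum_nat_const; apply: leq_sum => x _; apply: leq_trans (F_card x) _.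
rewrite leq_mul2l leq_add2l leq_mul2l expnS; apply/orP; right; apply: leq_mul.
  exact: max_card.
apply: leq_trans (max_card _) _; rewrite !card_prod.
by rewrite mulnA.
Qed.

End Recursion.

(** * Decomposition along homogeneous sets and clique cutsets *)

Definition induced_adj (G : sgraph) (B : {set G}) : rel {x : G | x \in B} :=
  fun x y => adj (val x) (val y).

Fact induced_adj_sym (G : sgraph) (B : {set G}) : symmetric (@induced_adj G B).
Proof. by move=> x y; exact: adj_sym. Qed.

Fact induced_adj_irrefl (G : sgraph) (B : {set G}) :
  irreflexive (@induced_adj G B).
Proof. by move=> x; exact: adj_irrefl. Qed.

Definition induced (G : sgraph) (B : {set G}) : sgraph :=
  SGraph (@induced_adj_sym G B) (@induced_adj_irrefl G B).

Lemma apple_free_induced (G : sgraph) (B : {set G}) :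
  apple_free G -> apple_free (induced B).
Proof.
move=> afG k k4 [f f_inj fE]; apply: (afG k k4).
exists (fun x => val (f x)) => [x y /val_inj/f_inj // | x y]; exact: fE.
Qed.

Definition nonadjacent (G : sgraph) (B : {set G}) : {set G * G} :=
  [set e | [&& e.1 \in B, e.2 \in B, e.1 != e.2 & ~~ adj e.1 e.2]].

Lemma card_nonadjacent_induced (G : sgraph) (B : {set G}) :
  #|nonadjacent [set: induced B]| <= #|nonadjacent B|.
Proof.
have val_inj2 : injective (fun e : induced B * induced B => (val e.1, val e.2)).
  by move=> [x y] [x' y'] /= [/val_inj-> /val_inj->].
rewrite -(card_imset _ val_inj2); apply: subset_leq_card; apply/subsetP => e.
case/imsetP => -[x y]; rewrite !inE /= => /andP[xy xNy] ->.
by apply/and4P; split=> //; exact: valP.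
Qed.

(** The trace of [S] on [B] may stand for [S], because the cuts themselves lie in [B]. *)
Lemma cuts_off_induced (G : sgraph) (B : {set G}) (F : {set {set induced B}}) :
  cuts_off setT F ->
  exists2 F' : {set {set G}}, #|F'| <= #|F| &
    cuts_off B F' /\ forall W, W \in F' -> W \subset B.
Proof.
move=> F_off; exists [set val @: W | W : {set induced B} in F].
  exact: leq_imset_card.
split=> [K S cK stS KS KB|W /imsetP[W0 _ ->]]; last first.
  by apply/subsetP => _ /imsetP[x _ ->]; exact: valP.
pose pre (X : {set G}) : {set induced B} := [set x | val x \in X].
have [|||//|W WF /andP[KW WS]] := F_off (pre K) (pre S).
- by move=> x y; rewrite !inE => xK yK xy; apply: cK.
- by move=> x y; rewrite !inE => xS yS; apply: stS.
- rewrite -setI_eq0; apply/eqP/setP => x; rewrite !inE.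
  by apply/negP => /andP[xK]; rewrite (disjointFr KS xK).
exists (val @: W); first exact: imset_f.
apply/andP; split.
  apply/subsetP => k kK; apply/imsetP.
  by exists (exist _ k (subsetP KB k kK)); rewrite //= (subsetP KW) // inE.
rewrite -setI_eq0; apply/eqP/setP => s; rewrite !inE; apply/negP.
case/andP => /imsetP[x xW ->] xS; have := disjointFr WS xW.
by rewrite inE xS.
Qed.

(* Superadditive under both decompositions: for a homogeneous set M the
   cardinals of M and its quotient add up to #|G|.+1, while for a clique cutset at
   least one nonadjacent pair is lost, which pays for the duplicated clique. *)
Definition potential (N : nat) (G : sgraph) (B : {set G}) : nat :=
  maxn 1 (N * #|nonadjacent B| + #|B|.-1).

Lemma cuts_off_module (G : sgraph) (M : {set G}) (m : G)
    (F1 F2 : {set {set G}}) :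
  homogeneous M -> m \in M -> cuts_off M F1 -> cuts_off (m |: ~: M) F2 ->
  (forall W, W \in F1 -> W \subset M) ->
  exists2 F, cuts_off [set: G] F & #|F| <= #|F1| + #|F2|.
Proof.
move=> homM mM F1_off F2_off F1M.
(* K and S either both meet M, and are cut within M, or survive the contraction
   of M to m. *)
pose ext1 (W : {set G}) := W :|: [set t | (t \notin M) && adj t m].
pose ext2 (W : {set G}) := [set y | if y \in M then m \in W else y \in W].
exists ((ext1 @: F1) :|: (ext2 @: F2)); last first.
  apply: leq_trans (leq_card_setU _ _) _.
  by apply: leq_add; exact: leq_imset_card.
move=> K S cK stS KS _.
case: (boolP ((K :&: M != set0) && (S :&: M != set0))) => [|NKS].
  case/andP => /set0Pn[k0 /setIP[k0K k0M]] /set0Pn[s0 /setIP[s0S s0M]].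
  have [||||W WF /andP[KW WS]] := F1_off (K :&: M) S => //.
  - by move=> x y /setIP[xK _] /setIP[yK _]; exact: cK.
  - by apply: disjointWl KS; exact: subsetIl.
  - exact: subsetIr.
  (* As both meet [M], a vertex outside [M] is complete to [M] if it is in [K] and anticomplete if
     it is in [S]; adjacency to [m] tells them apart. *)
  exists (ext1 W); first by rewrite in_setU imset_f.
  apply/andP; split.
    apply/subsetP => k kK; rewrite !inE; case: (boolP (k \in M)) => kM /=.
      by rewrite (subsetP KW) // inE kK.
    rewrite (homM m k0 k) // cK ?orbT //.
    by apply/eqP => E; rewrite E k0M in kM.
  rewrite -setI_eq0; apply/eqP/setP => s; rewrite !inE; apply/negP.
  case/andP => /orP[sW sS|/andP[sM sm] sS].
    by rewrite (disjointFr WS sW) in sS.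
  by have := stS s s0 sS s0S; rewrite -(homM m s0 s) // sm.
(* The trace on the quotient, where the part in [M] shrinks to [m]. The traces stay disjoint since
   [K] and [S] do not both meet [M]. *)
pose rep (X : {set G}) :=
  [set y | if y \in M then (y == m) && (X :&: M != set0) else y \in X].
have cK' : clique (rep K).
  have Km k : k \notin M -> k \in K -> K :&: M != set0 -> adj k m.
    move=> kM kK /set0Pn[k0 /setIP[k0K k0M]]; rewrite (homM m k0 k) //.
    by apply: cK => //; apply/eqP => E; rewrite E k0M in kM.
  move=> x y; rewrite !inE; case: (boolP (x \in M)) => xM; case: (boolP (y \in M)) => yM.
  - by move=> /andP[/eqP-> _] /andP[/eqP-> _]; rewrite eqxx.
  - by move=> /andP[/eqP-> KM] yK _; rewrite adj_sym Km.
  - by move=> xK /andP[/eqP-> KM] _; rewrite Km.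
  - exact: cK.
have stS' : stable (rep S).
  have Sm s : s \notin M -> s \in S -> S :&: M != set0 -> ~~ adj s m.
    move=> sM sS /set0Pn[s0 /setIP[s0S s0M]]; rewrite (homM m s0 s) //.
    exact: stS.
  move=> x y; rewrite !inE; case: (boolP (x \in M)) => xM; case: (boolP (y \in M)) => yM.
  - by move=> /andP[/eqP-> _] /andP[/eqP-> _]; rewrite adj_irrefl.
  - by move=> /andP[/eqP-> SM] yS; rewrite adj_sym Sm.
  - by move=> xS /andP[/eqP-> SM]; rewrite Sm.
  - exact: stS.
have KS' : [disjoint rep K & rep S].
  rewrite -setI_eq0; apply/eqP/setP => x; rewrite !inE; case: ifP => xM.
    apply/negP => /andP[/andP[_ KM] /andP[_ SM]]; by rewrite KM SM in NKS.
  by apply/negP => /andP[xK]; rewrite (disjointFr KS).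
have [|W WF /andP[KW WS]] := F2_off _ _ cK' stS' KS'.
  apply/subsetP => x; rewrite !inE; case: ifP => [xM /andP[->] //|xM _].
  by rewrite orbT.
exists (ext2 W); first by rewrite in_setU imset_f ?orbT.
apply/andP; split.
  apply/subsetP => k kK; rewrite inE; case: ifP => kM; apply: (subsetP KW).
    by rewrite inE mM eqxx; apply/set0Pn; exists k; rewrite inE kK.
  by rewrite inE kM.
rewrite -setI_eq0; apply/eqP/setP => s; rewrite !inE; apply/negP.
case: ifP => sM /andP[sW sS].
  have SM : S :&: M != set0 by apply/set0Pn; exists s; rewrite inE sS.
  by have := disjointFr WS sW; rewrite inE mM eqxx SM.
by have := disjointFr WS sW; rewrite inE sM sS.
Qed.

(** A clique meeting [X] lies in [X :|: boundary X], any other one in [~: X]. *)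
Lemma cuts_off_cutset (G : sgraph) (X : {set G}) (F1 F2 : {set {set G}}) :
  cuts_off (X :|: boundary X) F1 -> cuts_off (~: X) F2 ->
  cuts_off [set: G] (F1 :|: F2).
Proof.
move=> F1_off F2_off K S cK stS KS _.
case: (set_0Vmem (K :&: X)) => [KX0|[k0 /setIP[k0K k0X]]].
  have [|W WF Wsep] := F2_off K S cK stS KS.
    by rewrite -disjoints_subset -setI_eq0 KX0.
  by exists W; rewrite // in_setU WF orbT.
have [|W WF Wsep] := F1_off K S cK stS KS.
  apply/subsetP => k kK; rewrite !inE; case: (boolP (k \in X)) => //= kX.
  apply/existsP; exists k0; rewrite k0X cK //.
  by apply/eqP => E; rewrite -E k0X in kX.
by exists W; rewrite // in_setU WF.
Qed.

(** The two parts share only [m], hence no nonadjacent pair. Both have at least two vertices, and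
    their terms [.-1] add up exactly to that of [G]. *)
Lemma potential_module (N : nat) (G : sgraph) (M : {set G}) (m : G) :
  m \in M -> 1 < #|M| -> M != setT ->
  potential N M + potential N (m |: ~: M) <= potential N [set: G].
Proof.
move=> mM M_gt1 MT.
have cardM : #|M| + #|m |: ~: M| = #|G|.+1.
  by rewrite cardsU1 inE negbK mM -(cardsC M); lia.
have M_lt : #|M| < #|G|.
  by rewrite -cardsT; apply: proper_card; rewrite properT.
have ne : #|nonadjacent M| + #|nonadjacent (m |: ~: M)| <= #|nonadjacent [set: G]|.
  rewrite -cardsUI [_ :&: _](_ : _ = set0) ?cards0 ?addn0.
    by apply: subset_leq_card; apply/subsetP => e; rewrite !inE => /orP[]/and4P[_ _ -> ->].
  apply/setP => -[x y]; rewrite !inE /=; apply/negP.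
  case/andP => /and4P[-> -> xy _] /and4P[]; rewrite /= !orbF => /eqP-> /eqP yE.
  by rewrite yE eqxx.
have Ne := leq_mul (leqnn N) ne; rewrite mulnDr in Ne.
rewrite /potential cardsT; lia.
Qed.

(** No nonadjacent pair lies in both parts, whose overlap is a clique, and a pair from [X] to a
    vertex beyond the boundary lies in neither. The [N] saved covers the boundary counted twice. *)
Lemma potential_cutset (N : nat) (G : sgraph) (X : {set G}) : #|G| <= N ->
  X != set0 -> clique (boundary X) -> X :|: boundary X != setT ->
  potential N (X :|: boundary X) + potential N (~: X) <= potential N [set: G].
Proof.
move=> GN /set0Pn[x xX] cX; rewrite -properT => /properP[_ [y _ yN]].
have [yX yB] : y \notin X /\ y \notin boundary X.
  by move: yN; rewrite in_setU negb_or => /andP[].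
have XB : X :&: boundary X = set0.
  by apply/setP => z; rewrite !inE; case: (z \in X).
have cardB : #|X :|: boundary X| + #|~: X| = #|G| + #|boundary X|.
  by have := cardsUI X (boundary X); rewrite XB cards0; have := cardsC X; lia.
have B_lt : #|boundary X| + 2 <= #|G|.
  rewrite -(cardsC (boundary X)) leq_add2l.
  have <- : #|[set x; y]| = 2.
    by rewrite cards2; case: eqP => // E; rewrite -E xX in yX.
  apply: subset_leq_card; apply/subsetP => z; rewrite !inE => /orP[]/eqP->.
    by rewrite xX.
  by move: yB; rewrite inE.
have X_gt0 : 0 < #|X| by apply/card_gt0P; exists x.
have ne : #|nonadjacent (X :|: boundary X)| + #|nonadjacent (~: X)| + 1 <=
    #|nonadjacent [set: G]|.
  rewrite -cardsUI [_ :&: _](_ : _ = set0) ?cards0 ?addn0.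
    rewrite addn1; apply: proper_card; apply/properP; split.
      by apply/subsetP => e; rewrite !inE => /orP[]/and4P[_ _ -> ->].
    have xy : ~~ adj x y.
      apply: contra yB => xy; rewrite inE yX; apply/existsP.
      by exists x; rewrite xX.
    exists (x, y).
      by rewrite !inE /= xy andbT; apply/eqP => E; rewrite -E xX in yX.
    rewrite in_setU negb_or; apply/andP; split; rewrite inE /=.
      by rewrite [y \in _](negPf yN) andbF.
    by rewrite in_setC xX.
  apply/setP => -[a b]; rewrite in_set0; apply/negP; rewrite in_setI.
  case/andP; rewrite inE => /and4P[/= aB bB ab aNb].
  rewrite inE => /and4P[/=]; rewrite !in_setC => aX bX _ _.
  move: aB bB; rewrite !in_setU (negPf aX) (negPf bX) /= => aB bB.
  by case/negP: aNb; exact: cX.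
have C_gt0 : 0 < #|~: X| by apply/card_gt0P; exists y; rewrite inE.
have XB_gt0 : 0 < #|X :|: boundary X|.
  by apply: leq_trans X_gt0 _; apply: subset_leq_card; exact: subsetUl.
have Ne := leq_mul (leqnn N) ne; rewrite !mulnDr muln1 in Ne.
rewrite /potential cardsT; lia.
Qed.

(** * Assembling the polynomial bound *)

Definition prime_bound (N : nat) : nat :=
  1 + N * (N.+1 ^ 10 * (1 + 2 * N ^ 4)).

(** [N] stays fixed while [G] shrinks in the induction, so that the potentials of the parts compare
    with that of the whole. *)
Lemma cuts_off_apple_free (N : nat) (G : sgraph) : #|G| <= N -> apple_free G ->
  exists2 F : {set {set G}}, cuts_off setT F &
    #|F| <= prime_bound N * potential N [set: G].
Proof.
move: {2}#|G|.+1 (ltnSn #|G|) => n; elim: n G => // n IHn G leGn GN afG.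
have sub (B : {set G}) : #|B| < #|G| -> exists2 F : {set {set G}},
    cuts_off B F & (forall W, W \in F -> W \subset B) /\
    #|F| <= prime_bound N * potential N B.
  move=> B_lt; have cardB : #|induced B| = #|B| by rewrite card_sig.
  have [|||F F_off F_le] := IHn (induced B).
  - by rewrite cardB; lia.
  - by rewrite cardB; lia.
  - exact: apple_free_induced.
  have [F' F'_le [F'_off F'B]] := cuts_off_induced F_off.
  exists F' => //; split=> //; apply: leq_trans F'_le (leq_trans F_le _).
  rewrite leq_mul2l /potential cardsT cardB; apply/orP; right.
  have := leq_mul (leqnn N) (card_nonadjacent_induced B); lia.
pose hom (M : {set G}) :=
  [forall x in M, forall y in M, forall t in ~: M, adj t x == adj t y].
have homP M : reflect (homogeneous M) (hom M).
  apply: (iffP forall_inP) => [homM x y t xM yM tM|homM x xM].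
    have /forall_inP/(_ y yM)/forall_inP/(_ t) := homM x xM.
    by rewrite inE => /(_ tM)/eqP.
  apply/forall_inP => y yM; apply/forall_inP => t; rewrite inE => tM.
  by apply/eqP; exact: homM.
case: (boolP [exists M : {set G}, [&& hom M, 1 < #|M| & M != setT]]).
  case/existsP => M /and3P[/homP homM M_gt1 MT].
  have /card_gt0P[m mM] : 0 < #|M| by lia.
  have M_lt : #|M| < #|G| by rewrite -cardsT; apply: proper_card; rewrite properT.
  have [F1 F1_off [F1M F1_le]] := sub M M_lt.
  have [|F2 F2_off [_ F2_le]] := sub (m |: ~: M).
    by rewrite cardsU1 inE negbK mM; have := cardsC M; lia.
  have [F F_off F_le] := cuts_off_module homM mM F1_off F2_off F1M.
  exists F => //; apply: leq_trans F_le (leq_trans (leq_add F1_le F2_le) _).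
  by rewrite -mulnDr leq_mul2l potential_module ?orbT.
move=> /existsPn noM; have prG : prime_graph G.
  move=> M /homP homM M_gt1; apply/eqP; have := noM M.
  by rewrite homM M_gt1 /= negbK.
pose cliqueb (C : {set G}) := [forall x in C, forall y in C, (x != y) ==> adj x y].
have cliqueP C : reflect (clique C) (cliqueb C).
  apply: (iffP forall_inP) => [cC x y xC yC xy|cC x xC].
    by have /forall_inP/(_ y yC)/implyP/(_ xy) := cC x xC.
  by apply/forall_inP => y yC; apply/implyP; exact: cC.
case: (boolP [exists X : {set G},
    [&& X != set0, cliqueb (boundary X) & X :|: boundary X != setT]]).
  case/existsP => X /and3P[X0 /cliqueP cX XT].
  have [|F1 F1_off [_ F1_le]] := sub (X :|: boundary X).
    by rewrite -cardsT; apply: proper_card; rewrite properT.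
  have [|F2 F2_off [_ F2_le]] := sub (~: X).
    by have := cardsC X; have /card_gt0P := set0Pn _ X0; lia.
  exists (F1 :|: F2); first exact: (cuts_off_cutset F1_off F2_off).
  apply: leq_trans (leq_card_setU _ _) (leq_trans (leq_add F1_le F2_le) _).
  by rewrite -mulnDr leq_mul2l; apply/orP; right; exact: potential_cutset.
move=> /existsPn noX; have ccfG : clique_cutset_free G.
  move=> X X0 /cliqueP cX; apply/eqP; have := noX X.
  by rewrite X0 cX /= negbK.
have [F F_off F_le] := cuts_off_prime afG prG ccfG.
exists F => //; apply: leq_trans F_le _.
(* Here the [maxn 1] in [potential] provides positivity. *)
apply: leq_trans (leq_pmulr _ _); last by rewrite /potential leq_max.
rewrite leq_add2l; apply: leq_mul => //; apply: leq_mul; first by rewrite leq_exp2r.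
by rewrite leq_add2l leq_mul2l leq_exp2r.
Qed.

Theorem theorem7 : poly_CS_separation apple_free.
Proof.
(* The first factor is [prime_bound]. The second bounds the potential for [N] equal to the number
   [n] of vertices, as there are at most [n ^ 2] ordered nonadjacent pairs. *)
pose P : {poly nat} :=
  ((1%:P + 'X * (('X + 1%:P) ^+ 10 * (1%:P + 2%:P * 'X^4))) * (1%:P + ('X^3 + 'X)))%R.
have PE n : horner P n = prime_bound n * (1 + (n ^ 3 + n)).
  rewrite !(hornerM, hornerD, hornerXn, hornerX, hornerC).
  by rewrite /prime_bound -[n.+1]addn1 !expnS !expn0 !muln1.
exists P => G afG; rewrite PE.
have [F F_off F_le] := cuts_off_apple_free (leqnn #|G|) afG.
exists [set (W, ~: W) | W in F].
  split=> [c /imsetP[W _ ->]|K S cK stS KS].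
    by rewrite /is_cut /= setUCr eqxx -setI_eq0 setICr /=.
  have [|W WF /andP[KW WS]] := F_off K S cK stS KS; first exact: subsetT.
  exists (W, ~: W); first exact: imset_f.
  by rewrite /separates /= KW -disjoints_subset disjoint_sym.
apply: leq_trans (leq_imset_card _ _) (leq_trans F_le _).
rewrite leq_mul2l /potential cardsT; apply/orP; right.
have : #|nonadjacent [set: G]| <= #|G| ^ 2 by rewrite expnS expn1 -card_prod; exact: max_card.
by move/(leq_mul (leqnn #|G|)); rewrite -expnS; lia.
Qed.
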